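(* Let $(\Omega,\Sigma,\mu)$ be a non-atomic measure space, let $\mathcal{F}$ be a finite collection of sets in $\Sigma$ with $0<\mu(Q)<\infty$ for all $Q\in\mathcal{F}$, and let $\mathcal{P}_0(\mathcal{F})$ (defined in the context) be given. Let $\Lambda\ge1$ and suppose that $\mathcal{F}$ satisfies the $\Lambda$-Carleson condition, i.e. $\sum_{Q\in\mathcal{A}}\mu(Q)\le\Lambda\,\mu\left(\bigcup_{Q\in\mathcal{A}}Q\right)$ for every subcollection $\mathcal{A}\subseteq\mathcal{F}$. Then the output $\{E_Q\}_{Q\in\mathcal{F}}$ of the set-construction algorithm described in the context satisfies $E_Q\subseteq Q$ for all $Q\in\mathcal{F}$, $$\mu(E_Q)\ \ge\ \tfrac1\Lambda\,\mu(Q),\qquad Q\in\mathcal{F},$$ and the sets $\{E_Q\}_{Q\in\mathcal{F}}$ are (pairwise) disjoint. The runtime of this algorithm is $$O\left(m\cdot\mathrm{EO}_1+nm\cdot\mathrm{EO}_2+n^2m+nm^2\right),$$ where $n=|\mathcal{F}|$, $m=|\mathcal{P}_0(\mathcal{F})|$, $\mathrm{EO}_1$ is the time needed for one call to the oracle which, given $\mathcal{A}\subseteq\mathcal{F}$, returns $\mu\left(\bigcup_{Q\in\mathcal{A}}Q\right)$, and $\mathrm{EO}_2$ is the time needed for one call to the oracle which, given $E\in\Sigma$ and $a\in[0,1]$, returns a set $E_a\subseteq E$ in $\Sigma$ with $\mu(E_a)=a\,\mu(E)$.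
   Context: A collection is an unordered sequence of sets that allows for repeated elements; subcollections, unions, intersections and $|\mathcal{F}|$ are understood accordingly (i.e. $\mathcal{F}$ is an indexed family, and subcollections correspond to subsets of the index set). $\mathcal{P}(\mathcal{F})$ denotes the powerset of $\mathcal{F}$. Atoms of the generated $\sigma$-algebra. It is assumed that $\Omega=\bigcup_{Q\in\mathcal{F}}Q$. For $\mathcal{A}\subseteq\mathcal{F}$ let $$E_{\mathcal{A}}:=\Big(\bigcap_{Q\in\mathcal{A}}Q\Big)\cap\Big(\bigcap_{Q\in\mathcal{F}\setminus\mathcal{A}}Q^{\mathrm{c}}\Big),$$ and it is assumed (after discarding $\mu$-null sets) that for every $\mathcal{A}\subseteq\mathcal{F}$ either $E_{\mathcal{A}}=\emptyset$ or $\mu(E_{\mathcal{A}})>0$. Set $\mathcal{P}_0(\mathcal{F}):=\{\mathcal{A}\in\mathcal{P}(\mathcal{F}):E_{\mathcal{A}}\ne\emptyset\}$. Graph. Let $G=(V,E,c)$ be the weighted directed graph with vertices: a source $s$, a sink $t$, a vertex $v_Q$ for each $Q\in\mathcal{F}$, and a vertex $v_{\mathcal{A}}$ for each $\mathcal{A}\in\mathcal{P}_0(\mathcal{F})$ (all distinct); and edges with capacities $c:E\to[0,\infty]$: - $(s,v_{\mathcal{A}})$ with $c(s,v_{\mathcal{A}})=\mu(E_{\mathcal{A}})$, for $\mathcal{A}\in\mathcal{P}_0(\mathcal{F})$; - $(v_{\mathcal{A}},v_Q)$ with $c(v_{\mathcal{A}},v_Q)=\infty$, for $\mathcal{A}\in\mathcal{P}_0(\mathcal{F})$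 and $Q\in\mathcal{A}$; - $(v_Q,t)$ with $c(v_Q,t)=\Lambda^{-1}\mu(Q)$, for $Q\in\mathcal{F}$. Flows. A flow is a function $f:E\to[0,\infty)$ with $f(u,v)\le c(u,v)$ for all $(u,v)\in E$ and $\sum_{u:(u,v)\in E}f(u,v)=\sum_{w:(v,w)\in E}f(v,w)$ for all $v\in V\setminus\{s,t\}$. Its value is $|f|=\sum_{v:(s,v)\in E}f(s,v)$. A maximum flow is a flow of maximal value. Set-construction algorithm. Input: a finite collection $\mathcal{F}$ satisfying the $\Lambda$-Carleson condition. (1) Construct the graph $G$ (computing the measures $\mu(E_{\mathcal{A}})$, $\mathcal{A}\in\mathcal{P}_0(\mathcal{F})$, by means of the first oracle). (2) Compute a maximum flow $f$ from $s$ to $t$. (3) For each $Q\in\mathcal{F}$ set $E_Q=\emptyset$. (4) For each $\mathcal{A}\in\mathcal{P}_0(\mathcal{F})$: set $F=E_{\mathcal{A}}$; then for each $Q\in\mathcal{A}$ successively: take a set $F_Q\subseteq F$ with $\mu(F_Q)=f(v_{\mathcal{A}},v_Q)$ (by one call to the second oracle), update $E_Q\leftarrow E_Q\cup F_Q$, and update $F\leftarrow F\setminus F_Q$. Output: the sets $E_Q$, $Q\in\mathcal{F}$. Step (2) is carried out with Orlin's algorithm, which finds a maximum flow in a graph with runtime $O(|V||E|)$. In the runtime, elementary arithmetic operations and comparisons of real numbers, inclusion tests between elements of $\mathcal{P}_0(\mathcal{F})$, and the set updates in step (4) are counted as single steps. *)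

(* Defs.v *)
From HB Require Import structures.
From mathcomp Require Import all_boot all_order all_algebra.
From mathcomp Require Import all_classical all_reals all_analysis.

Set Implicit Arguments.
Unset Strict Implicit.
Unset Printing Implicit Defensive.
Import Order.TTheory GRing.Theory Num.Theory.
Local Open Scope classical_set_scope.
Local Open Scope ring_scope.

Definition non_atomic d (T : measurableType d) (R : realType)
    (mu : {measure set T -> \bar R}) : Prop :=
  forall A, measurable A -> (0 < mu A)%E ->
    exists B, [/\ measurable B, B `<=` A & (0 < mu B < mu A)%E].

(* A finite collection, with repetitions allowed, is a family indexed by a
   finite type [I]; its subcollections are the sets of indices. *)
Definition carleson d (T : measurableType d) (R : realType)
    (mu : {measure set T -> \bar R}) (I : finType) (F : I -> set T) (L : R) :=
  forall A : {set I},
    (\sum_(Q in A) mu (F Q) <= L%:E * mu (\bigcup_(Q in [set` A]) F Q))%E.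

Definition atom T (I : finType) (F : I -> set T) (A : {set I}) : set T :=
  (\bigcap_(Q in [set` A]) F Q) `&` (\bigcap_(Q in [set` ~: A]) ~` F Q).

Definition nonempty_atoms T (I : finType) (F : I -> set T) : {set {set I}} :=
  [set A | `[< atom F A !=set0 >]]%SET.

Record network (R : realType) := Network {
  node : finType;
  edges : {set node * node};
  source : node;
  sink : node;
  capacity : node * node -> \bar R }.

(* Only the values of a flow (and of the capacity) on the edges matter. *)
Definition flow (R : realType) (N : network R) := node N * node N -> R.

Definition is_flow (R : realType) (N : network R) (f : flow N) : Prop :=
  (forall e, e \in edges N -> 0 <= f e /\ ((f e)%:E <= capacity e)%E) /\
  (forall v, v != source N -> v != sink N ->
     \sum_(u | (u, v) \in edges N) f (u, v) =
     \sum_(w | (v, w) \in edges N) f (v, w)).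

Definition flow_value (R : realType) (N : network R) (f : flow N) : R :=
  \sum_(v | (source N, v) \in edges N) f (source N, v).

Definition is_max_flow (R : realType) (N : network R) (f : flow N) : Prop :=
  is_flow f /\ forall g : flow N, is_flow g -> flow_value g <= flow_value f.

(* A result with the number of steps spent on it. Sequencing is free, so that
   programs are to access numbers, sets and arrays through operations that are
   charged for. *)
Definition timed (X : Type) : Type := (X * nat)%type.
Definition result X (c : timed X) : X := c.1.
Definition time X (c : timed X) : nat := c.2.

Definition ret X (x : X) : timed X := (x, 0%N).
Definition steps X (k : nat) (x : X) : timed X := (x, k).
Definition step X (x : X) : timed X := steps 1 x.
Definition bind X Y (c : timed X) (k : X -> timed Y) : timed Y :=
  (result (k (result c)), (time c + time (k (result c)))%N).

Notation "x <-- c ;; k" := (bind c (fun x => k))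
  (at level 100, c at next level, right associativity).

Fixpoint foldM S X (body : S -> X -> timed S) (s : S) (xs : seq X) : timed S :=
  if xs is x :: xs' then (s' <-- body s x ;; foldM body s' xs') else ret s.

(* Infinite capacities are allowed, so that a network need not have a maximum
   flow; the solver is only constrained on the networks that have one. *)
Definition solves_max_flow (R : realType)
    (solver : forall N : network R, timed (flow N)) : Prop :=
  forall N : network R, (exists f : flow N, is_max_flow f) ->
    is_max_flow (result (solver N)).

(* The constant [K] is uniform in the network. *)
Definition max_flow_runtime_VE (R : realType)
    (solver : forall N : network R, timed (flow N)) : Prop :=
  exists K : nat, forall N : network R, (exists f : flow N, is_max_flow f) ->
    (0 < #|edges N|)%N ->
    (time (solver N) <= K * (#|node N| * #|edges N|))%N.

Definition union_oracle d (T : measurableType d) (R : realType)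
    (mu : {measure set T -> \bar R}) (I : finType) (F : I -> set T)
    (EO1 : nat) (o1 : {set I} -> timed R) : Prop :=
  forall A : {set I},
    (result (o1 A))%:E = mu (\bigcup_(Q in [set` A]) F Q) /\
    (time (o1 A) <= EO1)%N.

Definition subset_oracle d (T : measurableType d) (R : realType)
    (mu : {measure set T -> \bar R})
    (EO2 : nat) (o2 : set T -> R -> timed (set T)) : Prop :=
  forall (E : set T) (a : R), measurable E -> 0 <= a <= 1 ->
    [/\ measurable (result (o2 E a)), result (o2 E a) `<=` E,
        mu (result (o2 E a)) = (a%:E * mu E)%E &
        (time (o2 E a) <= EO2)%N].

Section Vertex.
Variables (I J : finType).

Inductive vertex := Source | Sink | VSet of I | VAtom of J.

Definition vertex_code (v : vertex) : bool + (I + J) :=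
  match v with
  | Source => inl true
  | Sink => inl false
  | VSet Q => inr (inl Q)
  | VAtom A => inr (inr A)
  end.

Definition vertex_decode (c : bool + (I + J)) : vertex :=
  match c with
  | inl true => Source
  | inl false => Sink
  | inr (inl Q) => VSet Q
  | inr (inr A) => VAtom A
  end.

Lemma vertex_codeK : cancel vertex_code vertex_decode.
Proof. by case. Qed.

HB.instance Definition _ := Finite.copy vertex (can_type vertex_codeK).

End Vertex.
Arguments Source {I J}.
Arguments Sink {I J}.
Arguments VSet {I J}.
Arguments VAtom {I J}.

Section Algorithm.
Variables (R : realType) (T : Type) (I : finType) (F : I -> set T).
Variable P : {set {set I}}.

Definition member := {A : {set I} | A \in P}.

(* [w] gives the measures of the atoms, [c] the capacities of the edges
   into the sink. *)
Definition carleson_edge (e : vertex I member * vertex I member) : bool :=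
  match e with
  | (Source, VAtom A) => true
  | (VAtom A, VSet Q) => Q \in val A
  | (VSet Q, Sink) => true
  | _ => false
  end.

Definition carleson_capacity (w : member -> R) (c : I -> R)
    (e : vertex I member * vertex I member) : \bar R :=
  match e with
  | (Source, VAtom A) => (w A)%:E
  | (VAtom A, VSet Q) => +oo%E
  | (VSet Q, Sink) => (c Q)%:E
  | _ => 0%E
  end.

Definition carleson_network (w : member -> R) (c : I -> R) : network R :=
  @Network R (vertex I member) [set e | carleson_edge e]%SET Source Sink
    (carleson_capacity w c).

Definition leM (x y : R) : timed bool := step (x <= y).
Definition addM (x y : R) : timed R := step (x + y).
Definition subM (x y : R) : timed R := step (x - y).
Definition divM (x y : R) : timed R := step (x / y).
Definition subsetM (A B : member) : timed bool := step (val A \subset val B).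
Definition storeM (K : eqType) X (f : K -> X) (k : K) (x : X) :
  timed (K -> X) := step (fun k' => if k' == k then x else f k').
Definition complM (A : member) : timed {set I} := steps #|I| (~: val A)%SET.
Definition unionM (A B : set T) : timed (set T) := step (A `|` B).
Definition diffM (A B : set T) : timed (set T) := step (A `\` B).

Variables (L : R) (o1 : {set I} -> timed R) (o2 : set T -> R -> timed (set T)).
Variable max_flow : forall N : network R, timed (flow N).

(* Insertion in front of the first superset keeps a list sorted with respect
   to the partial order of inclusion. *)
Fixpoint insertM (A : member) (s : seq member) : timed (seq member) :=
  if s is B :: s' then
    (b <-- subsetM A B ;;
     if b then ret (A :: s)
     else (s'' <-- insertM A s' ;; ret (B :: s'')))
  else ret [:: A].

Definition sortM : timed (seq member) :=
  foldM (fun s A => insertM A s) [::] (enum {: member}).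

(* The points outside of all the [F Q] with [Q \notin A] are those of the
   atoms of the [B \subset A]; hence mu (atom F A) is the measure of the whole
   space, minus that of the union over [~: A], minus the measures of the
   atoms of the proper subsets of [A], which occur earlier in the list. *)
Definition atom_measures : timed (member -> R) :=
  order <-- sortM ;;
  total <-- o1 [set: I]%SET ;;
  res <-- foldM (fun (st : (member -> R) * seq member) A =>
    let: (w, earlier) := st in
    A' <-- complM A ;;
    u <-- o1 A' ;;
    r <-- subM total u ;;
    r' <-- foldM (fun r B => b <-- subsetM B A ;;
                             if b then subM r (w B) else ret r) r earlier ;;
    w' <-- storeM w A r' ;;
    ret (w', A :: earlier)) ((fun=> 0), [::]) order ;;
  ret res.1.

(* mu (F Q) is the sum of the measures of the atoms contained in [F Q]. *)
Definition set_measures (w : member -> R) : timed (I -> R) :=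
  foldM (fun q A =>
    foldM (fun q Q => x <-- addM (q Q) (w A) ;; storeM q Q x)
      q (enum (val A)))
    (fun=> 0) (enum {: member}).

Definition sink_capacities (q : I -> R) : timed (I -> R) :=
  foldM (fun c Q => x <-- divM (q Q) L ;; storeM c Q x) (fun=> 0) (enum I).

Definition build_network (w : member -> R) (c : I -> R) : timed (network R) :=
  let N := carleson_network w c in steps (#|node N| + #|edges N|) N.

(* The second argument of [o2] is a proportion: a subset of measure [x] of a
   set of measure [r] is requested with a = x / r, and with a = 0 if r = 0. *)
Definition proportionM (x r : R) : timed R :=
  b <-- leM r 0 ;; if b then ret 0 else divM x r.

Definition init_sets : timed (I -> set T) :=
  foldM (fun E Q => storeM E Q set0) (fun=> set0) (enum I).

(* [r] is the measure of the remaining part [X] of the atom. *)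
Definition distribute (w : member -> R) (f : member -> I -> R)
    (E : I -> set T) (A : member) : timed (I -> set T) :=
  X0 <-- step (atom F (val A)) ;;
  res <-- foldM (fun (st : (I -> set T) * set T * R) Q =>
    let: (E, X, r) := st in
    a <-- proportionM (f A Q) r ;;
    Y <-- o2 X a ;;
    EQ <-- unionM (E Q) Y ;;
    E' <-- storeM E Q EQ ;;
    X' <-- diffM X Y ;;
    r' <-- subM r (f A Q) ;;
    ret (E', X', r')) (E, X0, w A) (enum (val A)) ;;
  ret res.1.1.

(* The network is written out again in the call of [max_flow] because the type
   of its result depends on it; its construction is paid for once. *)
Definition set_construction : timed (I -> set T) :=
  w <-- atom_measures ;;
  q <-- set_measures w ;;
  c <-- sink_capacities q ;;
  _ <-- build_network w c ;;
  f <-- max_flow (carleson_network w c) ;;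
  E <-- init_sets ;;
  foldM (distribute w (fun A Q => f (VAtom A, VSet Q))) E (enum {: member}).

End Algorithm.

(* Main.v *)
Require Import Defs.
From mathcomp Require Import all_boot all_order all_algebra.
From mathcomp Require Import all_classical all_reals all_analysis.
From mathcomp Require Import zify.

Set Implicit Arguments.
Unset Strict Implicit.
Unset Printing Implicit Defensive.
Import Order.TTheory GRing.Theory Num.Theory.
Local Open Scope classical_set_scope.
Local Open Scope ring_scope.

(* The Carleson condition, divided by Lambda, is Hall's condition for
   transporting the masses mu(E_A) of the atoms to demands mu(Q) / Lambda, an
   atom E_A being allowed to serve the sets Q in A only. By the fractional form
   of Hall's theorem some flow therefore saturates all edges into the sink; so
   does every maximum flow, and the pieces of the atoms that the algorithm puts
   into E_Q have total measure f(v_Q, t) = mu(Q) / Lambda. The runtime bound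
   uses that n and m are positive: the space has a point, which lies in some Q
   and in some atom. *)

(** * A fractional form of Hall's theorem *)

Section FractionalHall.
Import fintype boot.finset.
Local Close Scope classical_set_scope.

Definition neighbours (I J : finType) (E : {set J * I}) (X : {set I}) : {set J} :=
  [set j | [exists i in X, (j, i) \in E]].

Lemma sum_decrease_at (R : zmodType) (I : finType) (f : I -> R) (a : I) (x : R)
    (S : {set I}) :
  \sum_(i in S) (f i - (if i == a then x else 0)) =
  \sum_(i in S) f i - (if a \in S then x else 0).
Proof.
rewrite sumrB; congr (_ - _).
case: ifPn => aS; last by rewrite big1 // => i iS; case: eqP aS => // <-; rewrite iS.
by rewrite (bigD1 a) //= eqxx big1 ?addr0 // => i /andP[_ /negPf ->].
Qed.

(** Induction on the number of edges. One edge is deleted after the least amount that must pass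
    through it has been sent; what remains is to verify Hall's condition for the reduced supplies
    and demands. Without edges, the condition on singletons makes every demand zero. *)
Lemma fractional_hall (R : realDomainType) (I J : finType) (E : {set J * I})
    (w : J -> R) (c : I -> R) :
  (forall j, 0 <= w j) -> (forall i, 0 <= c i) ->
  (forall X : {set I}, \sum_(i in X) c i <= \sum_(j in neighbours E X) w j) ->
  exists g : J -> I -> R,
    [/\ forall j i, 0 <= g j i,
        forall j i, (j, i) \notin E -> g j i = 0,
        forall j, \sum_i g j i <= w j &
        forall i, \sum_j g j i = c i].
Proof.
have [k] := ubnP #|E|; elim: k => // k IH in E w c *; rewrite ltnS => cardE w0 c0 hall.
have [E0|[[j0 i0] eE]] := set_0Vmem E.
  exists (fun _ _ => 0); split => //.
    by move=> j; rewrite big1.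
  move=> i; rewrite big1 //; apply/le_anti; rewrite c0 /=.
  have := hall [set i]; rewrite big_set1 [X in _ <= X]big1 // => j.
  by rewrite E0 inE => /existsP[i']; rewrite !inE andbF.
pose E' := E :\ (j0, i0).
pose N' := neighbours E'.
have N'i0 (X : {set I}) : i0 \notin X -> neighbours E X = N' X.
  move=> iX; apply/setP => j; rewrite !inE; apply: eq_existsb => i.
  rewrite !inE xpair_eqE; case: (i =P i0) => [->|_]; first by rewrite (negPf iX).
  by rewrite andbF.
have N'j0 (X : {set I}) j : j != j0 -> (j \in neighbours E X) = (j \in N' X).
  move=> jj0; rewrite !inE; apply: eq_existsb => i.
  by rewrite !inE xpair_eqE (negPf jj0).
have wS (A B : {set J}) : A \subset B -> \sum_(j in A) w j <= \sum_(j in B) w j.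
  move=> AB; rewrite [leRHS](big_setID A) /= (setIidPr AB) lerDl.
  by apply: sumr_ge0 => j _.
(* Sums over sets are modular; the submodularity step below combines unions and intersections
   through this. *)
have UI (K : finType) (h : K -> R) (A B : {set K}) : \sum_(x in A :|: B) h x
    + \sum_(x in A :&: B) h x = \sum_(x in A) h x + \sum_(x in B) h x.
  have U : \sum_(x in A :|: B) h x = \sum_(x in A) h x + \sum_(x in B :\: A) h x.
    by rewrite (big_setID A) /= setIUl setIid (setUidPl _) ?subsetIr // setDUl
      setDv set0U.
  by rewrite U -addrA; congr (_ + _); rewrite [RHS](big_setID A) /= setIC addrC.
(* The least amount that has to go through the edge (j0, i0): the demand of
   some Y that the other edges cannot meet. Send it and delete the edge. *)
pose eps := \big[Num.max/0]_(Y : {set I} | i0 \in Y)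
  (\sum_(i in Y) c i - \sum_(j in N' Y) w j).
have eps_ge (Y : {set I}) : i0 \in Y -> \sum_(i in Y) c i - \sum_(j in N' Y) w j <= eps.
  by move=> iY; apply: (@le_bigmax_cond _ R).
have eps_ge0 : 0 <= eps by apply: bigmax_ge_id.
(* Deleting the edge costs [Y] at most the neighbour [j0], so the deficit of [Y] is at most
   [w j0]. *)
have eps_w : eps <= w j0.
  apply: bigmax_le => // Y iY; rewrite lerBlDr; apply: le_trans (hall Y) _.
  have /wS/le_trans -> // : neighbours E Y \subset j0 |: N' Y.
    apply/subsetP => j jN; rewrite in_setU1; case: eqVneq => //= jj0.
    by rewrite -N'j0.
  case: (boolP (j0 \in N' Y)) => jY; last by rewrite big_setU1.
  by rewrite (setUidPr _) ?sub1set // lerDr.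
(* All neighbours of [Y] without [i0] survive the deletion, so the deficit of [Y] is at most the
   demand of [i0]. *)
have eps_c : eps <= c i0.
  apply: bigmax_le => // Y iY; rewrite lerBlDr (big_setD1 i0) //= lerD2l.
  apply: le_trans (hall _) _; rewrite N'i0 ?setD11 //; apply: wS.
  apply/subsetP => j; rewrite !inE => /existsP[i]; rewrite inE => /andP[/andP[_ iX] ijE].
  by apply/existsP; exists i; rewrite iX.
(* The case in which the supply drops and the demand does not. For [Y] containing [i0], Hall's
   condition is applied to [X :|: Y], whose neighbours lie in those of [X] and in [N' Y] because [X]
   already reaches [j0], and to [X :&: Y], which avoids [i0]. *)
have eps_slack (X : {set I}) : i0 \notin X -> j0 \in neighbours E X ->
    \sum_(i in X) c i + eps <= \sum_(j in neighbours E X) w j.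
  move=> iX jX; rewrite -lerBrDl; apply: bigmax_le => [|Y iY].
    by rewrite subr_ge0.
  (* Submodularity, for [N X] and [N' Y]. *)
  rewrite lerBlDr addrAC lerBrDl -UI -[leRHS]UI; apply: lerD.
    apply: le_trans (hall _) _; apply: wS; apply/subsetP => j jN.
    rewrite in_setU; case: (eqVneq j j0) => [->|jj0]; first by rewrite jX.
    move: jN; rewrite !N'j0 // !inE => /existsP[i]; rewrite !inE => /andP[/orP[] ? ?].
      by apply/orP; left; apply/existsP; exists i; rewrite !inE; apply/andP.
    by apply/orP; right; apply/existsP; exists i; rewrite !inE; apply/andP.
  apply: le_trans (hall _) _; apply: wS; apply/subsetP => j.
  rewrite N'i0 ?inE ?(negPf iX) // => /existsP[i]; rewrite !inE.
  move=> /andP[/andP[iX' iY'] ijE]; apply/andP; split.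
    by apply/existsP; exists i; rewrite iX'; case/andP: ijE.
  by apply/existsP; exists i; rewrite !inE iY'.
have [||||g [g0 gE gw gc]] := IH E' (fun j => w j - (if j == j0 then eps else 0))
    (fun i => c i - (if i == i0 then eps else 0)).
- by move: cardE; rewrite (cardsD1 (j0, i0)) eE.
- by move=> j; rewrite subr_ge0; case: eqP => [->|].
- by move=> i; rewrite subr_ge0; case: eqP => [->|].
(* Four cases, by whether the demand of [X] drops ([i0] in [X]) and whether its supply drops ([j0]
   in [N' X]). The choice of [eps] settles a drop of the demand alone, and [eps_slack] a drop of the
   supply alone. *)
- move=> X; rewrite !sum_decrease_at -/(N' X); case: (boolP (i0 \in X)) => iX.
    case: ifPn => jX; last by rewrite subr0 lerBlDr -lerBlDl eps_ge.
    rewrite lerD2r; apply: le_trans (hall X) _; apply: wS; apply/subsetP => j.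
    by case: (eqVneq j j0) => [->//|/N'j0 ->].
  rewrite -N'i0 // subr0; case: ifPn => jX; last by rewrite subr0.
  by rewrite lerBrDr eps_slack.
exists (fun j i => g j i + (if (j, i) == (j0, i0) then eps else 0)); split.
- by move=> j i; rewrite addr_ge0 //; case: ifP.
- move=> j i ijE; have ne : (j, i) != (j0, i0) by apply: contraNneq ijE => ->.
  by rewrite gE ?(negPf ne) ?addr0 // !inE (negPf ijE) andbF.
- move=> j; rewrite big_split /=; have := gw j; rewrite lerBrDr.
  apply: le_trans; rewrite lerD2l.
  case: eqVneq => [->|jj0].
    rewrite (bigD1 i0) //= eqxx big1 ?addr0 // => i ii0.
    by rewrite xpair_eqE (negPf ii0) andbF.
  by rewrite big1 // => i _; rewrite xpair_eqE (negPf jj0).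
- move=> i; rewrite big_split /= gc; case: eqVneq => [->|ii0].
    rewrite (bigD1 j0) //= eqxx big1 ?addr0 ?subrK // => j jj0.
    by rewrite xpair_eqE (negPf jj0).
  by rewrite big1 ?subr0 ?addr0 // => j _; rewrite xpair_eqE (negPf ii0) andbF.
Qed.

End FractionalHall.

(** * Atoms *)

(** The infinite-capacity edges of the network, as the bipartite graph to which Hall's theorem is
    applied. *)
Definition incidence (I : finType) (P : {set {set I}}) : {set member P * I} :=
  [set e : member P * I | e.2 \in val e.1]%SET.

Lemma in_neighbours_incidence (I : finType) (P : {set {set I}}) (S : {set I})
    (A : member P) :
  (A \in neighbours (incidence P) S) = ~~ [disjoint val A & S].
Proof.
rewrite inE disjoint_sym; apply/existsP/pred0Pn => -[Q].
  rewrite inE => /andP[QS QA]; exists Q; exact/andP.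
by move=> /andP[QS QA]; exists Q; rewrite inE; exact/andP.
Qed.

Section Atoms.
Variables (T : Type) (I : finType) (F : I -> set T).

Definition label (x : T) : {set I} := [set Q | `[< F Q x >]]%SET.

(** Atoms are the fibres of [label]; hence they are disjoint, and each point lies in exactly one of
    them. *)
Lemma atomP (A : {set I}) (x : T) : atom F A x <-> A = label x.
Proof.
split=> [[inA notinA]|->].
  apply/setP => Q; rewrite inE; apply/idP/asboolP => [/inA//|FQx].
  by apply: contraPT FQx => QA; apply: notinA; rewrite /= inE.
by split=> Q /=; rewrite !inE // => /asboolPn.
Qed.

Lemma label_nonempty x : label x \in nonempty_atoms F.
Proof. by rewrite inE; apply/asboolP; exists x; apply/atomP. Qed.

Lemma trivIset_atom (D : set (member (nonempty_atoms F))) :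
  trivIset D (fun A => atom F (val A)).
Proof. by move=> A B _ _ [x [/atomP Ax /atomP Bx]]; apply/val_inj; rewrite Ax. Qed.

Hypothesis cover : \bigcup_Q F Q = [set: T].

(** The covering hypothesis rules out the atom of the empty index set. So each atom lies in some
    [F Q], which makes its measure finite. *)
Lemma atom_nonempty (A : member (nonempty_atoms F)) : exists Q, Q \in val A.
Proof.
have := valP A; rewrite inE => /asboolP[x /atomP ->].
have [Q _ FQx] : (\bigcup_Q F Q) x by rewrite cover.
by exists Q; rewrite inE; apply/asboolP.
Qed.

End Atoms.

(** * Measures of unions as sums over atoms *)

Section AtomWeights.
Context d (T : measurableType d) (R : realType) (mu : {measure set T -> \bar R}).
Variables (I : finType) (F : I -> set T).
Hypothesis mF : forall Q, measurable (F Q).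

Lemma measurable_atom A : measurable (atom F A).
Proof.
apply: measurableI; apply: fin_bigcap_measurable => // Q _.
exact: measurableC.
Qed.

Hypothesis mu_fin : forall Q, (mu (F Q) < +oo)%E.
Hypothesis cover : \bigcup_Q F Q = [set: T].

Definition atom_weight (A : member (nonempty_atoms F)) : R := fine (mu (atom F (val A))).

Lemma mu_atom A : mu (atom F (val A)) = (atom_weight A)%:E.
Proof.
have [Q QA] := atom_nonempty cover A.
rewrite fineK // ge0_fin_numE ?measure_ge0 //; apply: le_lt_trans (mu_fin Q).
apply: le_measure; rewrite ?inE //; first exact: measurable_atom.
by move=> x [+ _]; apply.
Qed.

Lemma atom_weight_ge0 A : 0 <= atom_weight A.
Proof. exact: fine_ge0. Qed.

Lemma mu_union_atoms (p : {pred member (nonempty_atoms F)}) :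
  mu (\bigcup_(A in [set` p]) atom F (val A)) = (\sum_(A | p A) atom_weight A)%:E.
Proof.
rewrite measure_fin_bigcup //; last first.
- by move=> A _; apply: measurable_atom.
- exact: trivIset_atom.
rewrite -sumEFin -(bigfs _ (index_enum_uniq _)) => [|A _]; last by rewrite mem_index_enum.
by apply: eq_bigr => A _; rewrite /= mu_atom.
Qed.

(** The union is the disjoint union of the atoms whose index set meets [S]. This turns the Carleson
    condition into Hall's condition, and the answers of the first oracle into finite sums. *)
Lemma mu_union (S : {set I}) : mu (\bigcup_(Q in [set` S]) F Q) =
  (\sum_(A in neighbours (incidence (nonempty_atoms F)) S) atom_weight A)%:E.
Proof.
rewrite -mu_union_atoms; congr (mu _); apply/seteqP; split=> [x [Q QS FQx]|x [A]].
  exists (exist _ (label F x) (label_nonempty F x)); last exact/atomP.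
  rewrite /= in_neighbours_incidence; apply/pred0Pn; exists Q => /=.
  by rewrite inE; apply/andP; split => //; apply/asboolP.
rewrite /= in_neighbours_incidence => /pred0Pn[Q /andP[QA QS]] [inA _].
by exists Q => //; apply: inA.
Qed.

Lemma mu_set Q : mu (F Q) = (\sum_(A : member (nonempty_atoms F) | Q \in val A) atom_weight A)%:E.
Proof.
have := mu_union [set Q]%SET.
rewrite (_ : [set` _] = [set Q]); last by apply/seteqP; split=> q /=; rewrite inE => /eqP.
rewrite bigcup_set1 => ->; congr (_%:E); apply: eq_bigl => A.
by rewrite in_neighbours_incidence disjoint_sym disjoints1 negbK.
Qed.

End AtomWeights.

(** * Flows in the network *)

Lemma big_vertex (X : Type) (idx : X) (op : Monoid.com_law idx) (I J : finType)
    (h : vertex I J -> X) :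
  \big[op/idx]_v h v = op (op (h Source) (h Sink))
    (op (\big[op/idx]_Q h (VSet Q)) (\big[op/idx]_A h (VAtom A))).
Proof.
rewrite (reindex (@vertex_decode I J)) /=; last first.
  by exists (@vertex_code I J); [case=> [[]|[]] | move=> v _; apply: vertex_codeK].
by rewrite !big_sumType big_bool.
Qed.

Section CarlesonFlow.
Context (R : realType) (I : finType) (P : {set {set I}}).
Variables (w : member P -> R) (c : I -> R).
Let N := carleson_network w c.

Lemma sum_in_atom (f : flow N) A :
  \sum_(u | (u, VAtom A : node N) \in edges N) f (u, VAtom A) = f (Source, VAtom A).
Proof.
by rewrite big_mkcond big_vertex /= !inE /= !big1 ?addr0 // => *; rewrite inE.
Qed.

Lemma sum_out_atom (f : flow N) A :
  \sum_(v | (VAtom A : node N, v) \in edges N) f (VAtom A, v) =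
  \sum_(Q in val A) f (VAtom A, VSet Q).
Proof.
rewrite big_mkcond big_vertex /= !inE /= !add0r [X in _ + X]big1 ?addr0 => [|*].
  by rewrite [RHS]big_mkcond; apply: eq_bigr => Q _; rewrite inE.
by rewrite inE.
Qed.

Lemma sum_in_set (f : flow N) Q :
  \sum_(u | (u, VSet Q : node N) \in edges N) f (u, VSet Q) =
  \sum_(A : member P | Q \in val A) f (VAtom A, VSet Q).
Proof.
rewrite big_mkcond big_vertex /= !inE /= !add0r [X in X + _]big1 ?add0r => [|*].
  by rewrite [RHS]big_mkcond; apply: eq_bigr => A _; rewrite inE.
by rewrite inE.
Qed.

Lemma sum_out_set (f : flow N) Q :
  \sum_(v | (VSet Q : node N, v) \in edges N) f (VSet Q, v) = f (VSet Q, Sink).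
Proof.
by rewrite big_mkcond big_vertex /= !inE /= !big1 ?addr0 ?add0r // => *; rewrite inE.
Qed.

Lemma flow_valueE (f : flow N) : flow_value f = \sum_A f (Source, VAtom A).
Proof.
rewrite /flow_value big_mkcond big_vertex /= !inE /= !add0r [X in X + _]big1 ?add0r => [|*].
  by apply: eq_bigr => A _; rewrite inE.
by rewrite inE.
Qed.

(** The infinite capacities leave only nonnegativity on the middle edges, and the conservation laws
    reduce to one sum per atom and one per set. *)
Lemma is_flow_carleson (f : flow N) : is_flow f <->
  [/\ forall A, 0 <= f (Source, VAtom A) <= w A,
      forall (A : member P) Q, Q \in val A -> 0 <= f (VAtom A, VSet Q),
      forall Q, 0 <= f (VSet Q, Sink) <= c Q,
      forall A : member P, f (Source, VAtom A) = \sum_(Q in val A) f (VAtom A, VSet Q) &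
      forall Q, \sum_(A : member P | Q \in val A) f (VAtom A, VSet Q) = f (VSet Q, Sink)].
Proof.
split=> [[cap cons]|[capA capAQ capQ consA consQ]].
  split=> [A|A Q QA|Q|A|Q].
  - have [|f0 /= fw] := cap (Source, VAtom A); first by rewrite inE.
    by rewrite f0 -lee_fin.
  - by have [|] := cap (VAtom A, VSet Q); first by rewrite inE.
  - have [|f0 /= fc] := cap (VSet Q, Sink); first by rewrite inE.
    by rewrite f0 -lee_fin.
  - by rewrite -sum_in_atom -sum_out_atom; apply: cons.
  - by rewrite -sum_in_set -sum_out_set; apply: cons.
split.
  move=> [[||Q|A] [||Q'|A']]; rewrite inE //= => e.
  - by have /andP[] := capA A'; rewrite lee_fin.
  - by have /andP[] := capQ Q; rewrite lee_fin.
  - by rewrite leey capAQ.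
by move=> [||Q|A] // _ _; rewrite ?sum_in_set ?sum_out_set ?sum_in_atom ?sum_out_atom.
Qed.

(** Conservation at the atoms and at the sets makes both sides the same double sum over the middle
    edges. *)
Lemma flow_value_sinkE (f : flow N) : is_flow f ->
  flow_value f = \sum_Q f (VSet Q, Sink).
Proof.
move=> /is_flow_carleson[_ _ _ consA consQ]; rewrite flow_valueE.
under eq_bigr do rewrite consA; under [RHS]eq_bigr do rewrite -consQ.
by rewrite (exchange_big_dep predT).
Qed.

Lemma flow_value_le (f : flow N) : is_flow f -> flow_value f <= \sum_Q c Q.
Proof.
move=> ff; rewrite flow_value_sinkE //; move/is_flow_carleson : ff => [_ _ capQ _ _].
by apply: ler_sum => Q _; have /andP[] := capQ Q.
Qed.

Hypotheses (w0 : forall A, 0 <= w A) (c0 : forall Q, 0 <= c Q).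
Hypothesis hall : forall S : {set I},
  \sum_(Q in S) c Q <= \sum_(A in neighbours (incidence P) S) w A.

(** The transport plan given by Hall's theorem is the flow on the middle edges; the edge into an
    atom carries what the plan takes out of it, possibly less than its weight. *)
Lemma saturating_flow : exists2 f : flow N, is_flow f & flow_value f = \sum_Q c Q.
Proof.
have [g [g0 gE gw gc]] := fractional_hall w0 c0 hall.
pose f : flow N := fun e => match e with
  | (Source, VAtom A) => \sum_Q g A Q
  | (VAtom A, VSet Q) => g A Q
  | (VSet Q, Sink) => c Q
  | _ => 0 end.
have g_eq0 (A : member P) Q : Q \notin val A -> g A Q = 0 by move=> QA; rewrite gE // inE.
have ff : is_flow f.
  apply/is_flow_carleson; split=> /= [A|A Q _|Q|A|Q].
  - by rewrite gw sumr_ge0.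
  - exact: g0.
  - by rewrite c0 lexx.
  - by rewrite [RHS]big_mkcond; apply: eq_bigr => Q _; case: ifPn => // /g_eq0.
  - by rewrite -gc big_mkcond; apply: eq_bigr => A _; case: ifPn => // /g_eq0.
by exists f => //; rewrite flow_value_sinkE.
Qed.

(** Needed because the solver is specified only on networks that have a maximum flow. *)
Lemma max_flow_exists : exists f : flow N, is_max_flow f.
Proof.
have [f ff fv] := saturating_flow; exists f; split=> // h hf.
by rewrite fv flow_value_le.
Qed.

(** The value of a maximum flow is at least the sum of the sink capacities. Since no sink edge
    exceeds its capacity, none can fall short of it. *)
Lemma max_flow_saturates (f : flow N) Q : is_max_flow f ->
  \sum_(A : member P | Q \in val A) f (VAtom A, VSet Q) = c Q.
Proof.
move=> [ff fmax]; have [h hf hv] := saturating_flow.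
have := fmax _ hf; rewrite hv (flow_value_sinkE ff).
have /is_flow_carleson[_ _ capQ _ ->] := ff => le.
apply/le_anti; have /andP[_ -> /=] := capQ Q.
move: le; rewrite (bigD1 Q) //= [leRHS](bigD1 Q) //=; apply: contraTT.
rewrite -!ltNge => lt; apply: ltr_leD => //; apply: ler_sum => Q' _.
by have /andP[] := capQ Q'.
Qed.

End CarlesonFlow.

(** * Size of the network *)

Section NetworkSize.
Context (R : realType) (I : finType) (P : {set {set I}}).
Variables (w : member P -> R) (c : I -> R).
Let N := carleson_network w c.

Lemma card_member : #|{: member P}| = #|P|.
Proof. exact: card_sig. Qed.

Lemma card_node : #|node N| = (2 + (#|I| + #|P|))%N.
Proof.
transitivity (\sum_(v : vertex I (member P)) 1)%N; first by rewrite sum1_card.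
by rewrite big_vertex !sum1_card card_member.
Qed.

Lemma card_edges : (#|edges N| <= #|P| + #|I| + #|I| * #|P|)%N.
Proof.
have -> : #|edges N| = (\sum_(u : vertex I (member P)) \sum_(v : vertex I (member P))
    carleson_edge (u, v))%N.
  by rewrite pair_big cardsE -sum1_card [LHS]big_mkcond; apply: eq_bigr => -[].
have eS : (\sum_(v : vertex I (member P)) carleson_edge (Source, v) = #|P|)%N.
  by rewrite big_vertex /= big1 // sum1_card card_member.
have eT : (\sum_(v : vertex I (member P)) carleson_edge (Sink, v) = 0)%N.
  by rewrite big1.
have eQ Q : (\sum_(v : vertex I (member P)) carleson_edge (VSet Q, v) = 1)%N.
  by rewrite big_vertex /= !big1.
have eA (A : member P) : (\sum_v carleson_edge (VAtom A, v) <= #|I|)%N.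
  rewrite big_vertex /= [X in (_ + (_ + X))%N]big1 // !add0n addn0.
  by rewrite -sum1_card; apply: leq_sum => Q _; case: (_ \in _).
rewrite big_vertex eS eT (eq_bigr _ (fun Q _ => eQ Q)) sum1_card /= addn0 -addnA.
rewrite !leq_add2l -card_member mulnC -sum_nat_const.
by apply: leq_sum => A _; apply: eA.
Qed.

Lemma edges_gt0 : (0 < #|P|)%N -> (0 < #|edges N|)%N.
Proof.
move=> /card_gt0P[A PA]; apply/card_gt0P.
by exists (Source, VAtom (exist _ A PA)); rewrite inE.
Qed.
End NetworkSize.

(** * The program *)

Lemma result_bind X Y (c : timed X) (k : X -> timed Y) :
  result (bind c k) = result (k (result c)).
Proof. by []. Qed.

Lemma time_bind X Y (c : timed X) (k : X -> timed Y) :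
  time (bind c k) = (time c + time (k (result c)))%N.
Proof. by []. Qed.

(* The invariant refers to the list of the inputs that remain to be processed. *)
Lemma foldM_ind (S X : Type) (body : S -> X -> timed S) (inv : S -> seq X -> Prop)
    (k : nat) :
  (forall s x xs, inv s (x :: xs) ->
     inv (result (body s x)) xs /\ (time (body s x) <= k)%N) ->
  forall s xs, inv s xs ->
  inv (result (foldM body s xs)) [::] /\ (time (foldM body s xs) <= size xs * k)%N.
Proof.
move=> step s xs; elim: xs s => [|x xs IH] s //= /step[inv_s time_s].
have [inv_res time_res] := IH _ inv_s; split=> //.
by rewrite /= mulSn leq_add.
Qed.

(** * Sorting the atoms by inclusion *)

Section Sort.
Variables (I : finType) (P : {set {set I}}).
Implicit Types (A B : member P) (s : seq (member P)).

(** A linear extension of inclusion: in such a list of all members, the proper subsets of a set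
    precede it, as the recursion for the atom measures requires. *)
Definition inclusion_sorted s := pairwise (fun B C => ~~ (val C \subset val B)) s.

(** If [B] is the first superset of [A], nothing before it contains [A]. A set after [B] contained
    in [A] would be contained in [B], against the sortedness of the list; and [B] itself is not
    contained in [A], being a different set. *)
Lemma insertM_spec A s : A \notin s -> inclusion_sorted s ->
  [/\ perm_eq (result (insertM A s)) (A :: s), inclusion_sorted (result (insertM A s)) &
      (time (insertM A s) <= size s)%N].
Proof.
elim: s => [//|B s IH]; rewrite inE negb_or => /andP[AB As] /= /andP[Bs sorted_s].
case: ifPn => AsubB; last first.
  have [perm_res sorted_res time_res] := IH As sorted_s; split=> /=.
  - apply: (perm_trans (y := [:: B, A & s])); first by rewrite perm_cons.
    exact: (permEl (perm_catCA [:: B] [:: A] s)).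
  - apply/andP; split=> //; rewrite (perm_all _ perm_res) /= AsubB.
    exact: Bs.
  - by rewrite addn0 add1n ltnS.
split=> //=; rewrite sorted_s Bs !andbT; apply/andP; split.
  apply: contra AB => BsubA; apply/eqP/val_inj/eqP.
  by rewrite finset.eqEsubset AsubB.
by apply: sub_all Bs => C; apply: contra => /fintype.subset_trans; apply.
Qed.

Lemma sortM_spec : [/\ perm_eq (result (sortM P)) (enum {: member P}),
  inclusion_sorted (result (sortM P)) & (time (sortM P) <= #|P| * #|P|)%N].
Proof.
pose inv s todo := perm_eq (s ++ todo) (enum {: member P}) /\ inclusion_sorted s.
have step s A todo : inv s (A :: todo) ->
    inv (result (insertM A s)) todo /\ (time (insertM A s) <= #|P|)%N.
  move=> [perm_s sorted_s].
  have uniq_s : uniq (s ++ A :: todo) by rewrite (perm_uniq perm_s) enum_uniq.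
  have As : A \notin s by move: uniq_s; rewrite cat_uniq /= negb_or => /and3P[_ /andP[]].
  have [perm_res sorted_res time_res] := insertM_spec As sorted_s; split.
    split=> //; apply: perm_trans perm_s; rewrite -cat1s catA perm_cat2r.
    by apply: perm_trans perm_res _; rewrite -cat1s perm_catC.
  apply: leq_trans time_res _; have := perm_size perm_s.
  by rewrite -cardE card_member size_cat => <-; rewrite leq_addr.
have [|[perm_res sorted_res] time_res] := foldM_ind step (s := [::]) (xs := enum {: member P}).
  by split.
split=> //; first by rewrite cats0 in perm_res.
by rewrite -cardE card_member in time_res.
Qed.

End Sort.

(** * Atom measures from the measures of unions *)

Section AtomMeasures.
Variables (R : realType) (I : finType) (P : {set {set I}}) (EO1 : nat).
Variables (W : member P -> R) (o1 : {set I} -> timed R).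
Hypothesis o1_value : forall S, result (o1 S) = \sum_(A in neighbours (incidence P) S) W A.
Hypothesis o1_time : forall S, (time (o1 S) <= EO1)%N.
Hypothesis member_nonempty : forall A : member P, exists Q, Q \in val A.

Lemma subtract_subsets (w : member P -> R) (A : member P) (r : R) (s : seq (member P)) :
  let c := foldM (fun r B => b <-- subsetM B A ;; if b then subM r (w B) else ret r) r s in
  result c = r - \sum_(B <- s | val B \subset val A) w B /\ (time c <= size s * 2)%N.
Proof.
elim: s r => [|B s IH] r /=; first by rewrite big_nil subr0.
rewrite big_cons; case: ifP => _.
  have [-> time_s] := IH (r - w B); rewrite opprD addrA; split=> //.
have [-> time_s] := IH r; split=> //.
by rewrite mulSn; apply: (@leq_add _ _ 2).
Qed.

(** The time consists of the sort, the call for the total and, per atom, the complement, one call,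
    one subtraction, one store and two steps for each earlier atom. *)
Lemma atom_measures_spec :
  result (atom_measures P o1) = W /\
  (time (atom_measures P o1) <= #|P| * #|P| + EO1 + #|P| * (#|I| + EO1 + 2 + #|P| * 2))%N.
Proof.
have [perm_order sorted_order time_order] := sortM_spec P.
rewrite /atom_measures /=; set order := result (sortM P) in perm_order sorted_order *.
set total := result (o1 _).
set body := (X in foldM X).
(* [catrev], because the processed atoms are accumulated in reverse order. *)
pose inv (st : (member P -> R) * seq (member P)) todo :=
  catrev st.2 todo = order /\ {in st.2, st.1 =1 W}.
have uniq_order : uniq order by rewrite (perm_uniq perm_order) enum_uniq.
have size_order : size order = #|P| by rewrite (perm_size perm_order) -cardE card_member.
(* No index set is empty, so every atom counts in the union over all indices. *)
have totalE : total = \sum_B W B.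
  rewrite /total o1_value; apply: eq_bigl => B; rewrite in_neighbours_incidence.
  have [Q QB] := member_nonempty B; apply/pred0Pn; exists Q.
  by rewrite /= QB inE.
have step st A todo : inv st (A :: todo) -> inv (result (body st A)) todo /\
    (time (body st A) <= #|I| + EO1 + 2 + #|P| * 2)%N.
  case: st => w earlier [/= split_order wW].
  have [r'E time_r'] := subtract_subsets w A (total - result (o1 (~: val A)%SET)) earlier.
  rewrite catrevE in split_order.
  have size_earlier : (size earlier <= #|P|)%N.
    by rewrite -size_order -split_order size_cat size_rev leq_addr.
  have uE : result (o1 (~: val A)%SET) = \sum_(B : member P | ~~ (val B \subset val A)) W B.
    rewrite o1_value; apply: eq_bigl => B.
    by rewrite in_neighbours_incidence finset.disjoints_subset finset.setCK.
  (* The members included in [A] are [A] itself and some of the earlier ones; sortedness excludes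
     those still to come. *)
  have prefixE : \sum_(B : member P | val B \subset val A) W B =
      \sum_(B <- earlier | val B \subset val A) w B + W A.
    have perm_index : perm_eq order (index_enum (member P)).
      apply: uniq_perm => // [|B]; first exact: index_enum_uniq.
      by rewrite (perm_mem perm_order) mem_enum mem_index_enum.
    rewrite -(perm_big _ perm_index) -split_order big_cat big_rev /=.
    rewrite big_cons subxx; congr (_ + _).
      rewrite big_seq_cond [RHS]big_seq_cond; apply: eq_bigr => B /andP[BE _].
      by rewrite wW.
    rewrite big_seq_cond big_pred0 ?addr0 // => B; apply/negbTE/nandP.
    move: sorted_order; rewrite -split_order /inclusion_sorted pairwise_cat /=.
    case/and4P => _ _ /allP notin _; case: (boolP (B \in todo)) => [/notin|]; last by left.
    by right.
  have r'W : result (foldM (fun r B => b <-- subsetM B A ;; if b then subM r (w B) else ret r)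
      (total - result (o1 (~: val A)%SET)) earlier) = W A.
    rewrite r'E totalE uE (bigID (fun B : member P => val B \subset val A)) /= addrK prefixE.
    by rewrite addrC addKr.
  split; last first.
    have := o1_time (~: val A)%SET.
    move: time_r' size_earlier; rewrite /=.
    move: (time (foldM _ _ _)) (time (o1 _)) (size earlier) => a b c; lia.
  split=> //= [|B]; first by rewrite -split_order -catrevE.
  by rewrite inE r'W; case: eqP => [->//|_] /= /wW.
have [|[split_res resW] time_res] := foldM_ind step (s := (fun=> 0, [::])) (xs := order).
  by split.
split.
  apply/funext => A; apply: resW; rewrite catrevE cats0 in split_res.
  by rewrite -mem_rev split_res (perm_mem perm_order) mem_enum.
rewrite addn0 -addnA; apply: leq_add => //; apply: leq_add => //.
by rewrite -[X in (X * _)%N]size_order.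
Qed.

End AtomMeasures.

(** * Measures of the sets, sink capacities and initial sets *)

Section Capacities.
Variables (R : realType) (I : finType) (P : {set {set I}}).

Lemma set_measures_spec (w : member P -> R) :
  result (set_measures w) = (fun Q => \sum_(A : member P | Q \in val A) w A) /\
  (time (set_measures w) <= #|P| * (#|I| * 2))%N.
Proof.
pose body A q Q : timed (I -> R) := x <-- addM (q Q) (w A) ;; storeM q Q x.
have inner q (A : member P) :
    (forall Q, result (foldM (body A) q (enum (val A))) Q =
               q Q + (if Q \in val A then w A else 0)) /\
    (time (foldM (body A) q (enum (val A))) <= #|I| * 2)%N.
  (* The current value plus the contribution still due stays constant; [uniq] prevents [w A] from
     being added twice at one index. *)
  pose inv q' todo := uniq todo /\ forall Q : I,
    q' Q + (if Q \in todo then w A else 0) = q Q + (if Q \in val A then w A else 0).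
  have step q' Q todo : inv q' (Q :: todo) ->
      inv (result (body A q' Q)) todo /\ (time (body A q' Q) <= 2)%N.
    move=> [/= /andP[Qtodo todo_uniq] qE]; split=> //; split=> // Q' /=.
    rewrite -qE inE; case: eqP => [->|//] /=.
    by rewrite (negPf Qtodo) addr0.
  have [|[_ resE] time_res] := foldM_ind step (s := q) (xs := enum (val A)).
    by split=> [|Q]; rewrite ?enum_uniq ?mem_enum.
  split=> [Q|]; first by rewrite -resE addr0.
  by apply: leq_trans time_res _; rewrite leq_mul2r -cardE max_card.
pose inv (q : I -> R) (todo : seq (member P)) := forall Q,
  q Q + \sum_(A <- todo | Q \in val A) w A = \sum_(A : member P | Q \in val A) w A.
have step q A todo : inv q (A :: todo) ->
    inv (result (foldM (body A) q (enum (val A)))) todo /\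
    (time (foldM (body A) q (enum (val A))) <= #|I| * 2)%N.
  move=> qE; have [resE time_res] := inner q A; split=> // Q.
  by rewrite resE -qE big_cons -addrA; case: ifP => _; rewrite ?add0r.
have [|resE time_res] := foldM_ind step (s := fun=> 0) (xs := enum {: member P}).
  by move=> Q; rewrite add0r big_enum_cond.
split; last by rewrite -cardE card_member in time_res.
by apply/funext => Q; rewrite -resE big_nil addr0.
Qed.

Lemma sink_capacities_spec (L : R) (q : I -> R) :
  result (sink_capacities L q) = (fun Q => q Q / L) /\
  (time (sink_capacities L q) <= #|I| * 2)%N.
Proof.
pose inv (c : I -> R) (todo : seq I) := forall Q : I, Q \notin todo -> c Q = q Q / L.
pose body c Q : timed (I -> R) := x <-- divM (q Q) L ;; storeM c Q x.
have step c Q todo : inv c (Q :: todo) ->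
    inv (result (body c Q)) todo /\ (time (body c Q) <= 2)%N.
  move=> cE; split=> // Q' Q'todo /=; case: eqP => [->//|/eqP Q'Q].
  by rewrite cE // inE negb_or Q'Q.
have [|resE time_res] := foldM_ind step (s := fun=> 0) (xs := enum I).
  by move=> Q; rewrite mem_enum.
split; last by rewrite cardE.
by apply/funext => Q; rewrite -resE.
Qed.

Lemma init_sets_spec (T : Type) :
  result (init_sets T I) = (fun=> set0) /\ (time (init_sets T I) <= #|I|)%N.
Proof.
pose inv (E : I -> set T) (todo : seq I) := forall Q, E Q = set0.
have step E Q todo : inv E (Q :: todo) ->
    inv (result (storeM E Q set0)) todo /\ (time (storeM E Q set0) <= 1)%N.
  by move=> E0; split=> // Q' /=; case: ifP.
have [|resE time_res] := foldM_ind step (s := fun=> set0) (xs := enum I).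
  by [].
split; first by apply/funext => Q; rewrite -[RHS](resE Q).
by rewrite cardE -[X in (_ <= X)%N]muln1.
Qed.

End Capacities.

(** * Handing out the pieces of the atoms *)

Section Distribute.
Context d (T : measurableType d) (R : realType) (mu : {measure set T -> \bar R}).
Variables (I : finType) (F : I -> set T).
Hypothesis mF : forall Q, measurable (F Q).

(* [D] is the part of the space that has not been handed out yet. *)
Definition assigned (E : I -> set T) (D : set T) (a : I -> R) : Prop :=
  [/\ forall Q, measurable (E Q), forall Q, E Q `<=` F Q `\` D,
      forall Q, mu (E Q) = (a Q)%:E & trivIset setT E].

Lemma assigned_sub E (D D' : set T) a : D' `<=` D -> assigned E D a -> assigned E D' a.
Proof.
move=> DD' [mE EF muE tE]; split=> // Q x /EF[FQx NDx]; split=> // /DD'.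
exact: NDx.
Qed.

(** The sets built so far avoid [D], so a piece of [D] is disjoint from all of them: its measure
    adds up and disjointness persists. *)
Lemma assigned_add E D a Q Y y : measurable Y -> Y `<=` F Q `&` D -> mu Y = y%:E ->
  assigned E D a ->
  assigned (fun Q' => if Q' == Q then E Q `|` Y else E Q') (D `\` Y)
    (fun Q' => if Q' == Q then a Q + y else a Q').
Proof.
move=> mY YFD muY [mE EF muE tE].
have EY Q' : E Q' `&` Y = set0.
  by apply/seteqP; split=> // x [/EF[_ NDx] /YFD[_ /NDx]].
split=> [Q'|Q'|Q'|].
- by case: ifP => // _; apply: measurableU.
- case: eqP => [->|_] x; last by move=> /EF[? NDx]; split=> // -[].
  by move=> [/EF[? NDx]|Yx]; [split=> // -[] | split=> [|[]//]; case: (YFD _ Yx)].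
- case: eqP => // _; have -> : mu (E Q `|` Y) = (mu (E Q) + mu Y)%E by apply: measureU.
  by rewrite muE muY.
move=> Q1 Q2 _ _ [x []].
case: eqP => [->|Q1Q]; case: eqP => [->//|Q2Q].
- move=> [E1|Yx] E2; first by apply: tE => //; exists x.
  by have : (E Q2 `&` Y) x by []; rewrite EY.
- move=> E1 [E2|Yx]; first by apply: tE => //; exists x.
  by have : (E Q1 `&` Y) x by []; rewrite EY.
- by move=> E1 E2; apply: tE => //; exists x.
Qed.

Variables (EO2 : nat) (o2 : set T -> R -> timed (set T)).
Hypothesis o2_spec : subset_oracle mu EO2 o2.

(** In the branch [r <= 0] the bounds force [x = 0], so the default proportion 0 is the right
    one. *)
Lemma proportionM_spec (x r : R) : 0 <= x <= r ->
  [/\ 0 <= result (proportionM x r) <= 1, result (proportionM x r) * r = x &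
      (time (proportionM x r) <= 2)%N].
Proof.
move=> /andP[x0 xr]; rewrite /proportionM /=; case: (leP r 0) => [r0|r0] /=.
  have -> : x = 0 by apply/le_anti; rewrite x0 (le_trans xr).
  by rewrite mul0r lexx ler01.
by rewrite divr_ge0 ?(ltW r0) // ler_pdivrMr // mul1r xr divfK ?gt_eqF.
Qed.

Variable P : {set {set I}}.
Variables (w : member P -> R) (f : member P -> I -> R).
Hypothesis mu_atomE : forall A : member P, mu (atom F (val A)) = (w A)%:E.
Hypothesis f0 : forall (A : member P) Q, Q \in val A -> 0 <= f A Q.
Hypothesis fw : forall A : member P, \sum_(Q in val A) f A Q <= w A.

(** By [fw] the outflow of an atom is at most its weight, so the remainder always covers the pieces
    still due and each proportion passed to [o2] lies in [0, 1]. [D] stands for the atoms still to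
    be processed. *)
Lemma distribute_spec E (A : member P) (D : set T) (a : I -> R) :
  D `&` atom F (val A) = set0 -> assigned E (atom F (val A) `|` D) a ->
  assigned (result (distribute F o2 w f E A)) D
    (fun Q => a Q + (if Q \in val A then f A Q else 0)) /\
  (time (distribute F o2 w f E A) <= 1 + #|I| * (EO2 + 6))%N.
Proof.
move=> DA assigned_E.
rewrite /distribute.
set body := (X in foldM X).
pose inv (st : (I -> set T) * set T * R) (todo : seq I) :=
  [/\ uniq todo, {subset todo <= val A},
      [/\ measurable st.1.2, st.1.2 `<=` atom F (val A) & mu st.1.2 = st.2%:E],
      \sum_(Q <- todo) f A Q <= st.2 &
      assigned st.1.1 (st.1.2 `|` D)
        (fun Q => a Q + (if (Q \in val A) && (Q \notin todo) then f A Q else 0))].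
have step st Q todo : inv st (Q :: todo) ->
    inv (result (body st Q)) todo /\ (time (body st Q) <= EO2 + 6)%N.
  case: st => -[E' X] r [/= /andP[Qtodo todo_uniq] todoA [mX XA muX] sum_le assigned_E'].
  have QA : Q \in val A by apply: todoA; rewrite mem_head.
  have sum_todo : 0 <= \sum_(Q' <- todo) f A Q'.
    rewrite big_seq; apply: sumr_ge0 => Q' Q'todo; apply: f0; apply: todoA.
    by rewrite inE Q'todo orbT.
  rewrite big_cons in sum_le.
  have f_r : 0 <= f A Q <= r.
    by rewrite f0 //= (le_trans _ sum_le) // lerDl.
  have [p01 pE time_p] := proportionM_spec f_r.
  have [mY YX muY time_Y] := o2_spec mX p01.
  set Y := result (o2 X _) in mY YX muY.
  rewrite muX -EFinM pE in muY.
  have muXY : mu (X `\` Y) = (r - f A Q)%:E.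
    have -> : mu (X `\` Y) = (mu X - mu (X `&` Y))%E.
      by apply: measureD => //; rewrite [X in (X < _)%E]muX ltry.
    by rewrite (setIidr YX) muX muY.
  split.
    split=> //=.
    - by move=> Q' Q'todo; apply: todoA; rewrite inE Q'todo orbT.
    - by split=> //; [apply: measurableD | move=> x [/XA]].
    - by rewrite lerBrDl.
    have YF : Y `<=` F Q `&` (X `|` D).
      by move=> x /YX Xx; split; [have [+ _] := XA _ Xx; apply | left].
    have := assigned_add mY YF muY assigned_E'; rewrite mem_head andbF addr0.
    have -> : (fun Q' => if Q' == Q then a Q + f A Q else a Q' +
          (if (Q' \in val A) && (Q' \notin Q :: todo) then f A Q' else 0)) =
        (fun Q' => a Q' + (if (Q' \in val A) && (Q' \notin todo) then f A Q' else 0)).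
      apply/funext => Q'; rewrite inE; case: eqP => [->|//].
      by rewrite QA (negPf Qtodo).
    (* The program removes [Y] from [X] only; since [D] misses the atom, [Y] does not meet [D]
       either. *)
    apply: assigned_sub => x [[Xx NYx]|Dx]; first by split=> //; left.
    split; first by right.
    by move=> /YX/XA Ax; have : (D `&` atom F (val A)) x by []; rewrite DA.
  (* The 4 counts the union, the store, the difference and the subtraction; the proportion takes at
     most 2 more. *)
  change (time (proportionM (f A Q) r) +
    (time (o2 X (result (proportionM (f A Q) r))) + 4) <= EO2 + 6)%N.
  by clear -time_p time_Y; lia.
have [|[_ _ _ _ assigned_res] time_res] :=
    foldM_ind step (s := (E, atom F (val A), w A)) (xs := enum (val A)).
  split=> /=; rewrite ?enum_uniq //.
  - by move=> Q; rewrite mem_enum.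
  - by split; [apply: measurable_atom | | apply: mu_atomE].
  - by rewrite big_enum; apply: fw.
  - rewrite (_ : (fun Q => _) = a) //; apply/funext => Q.
    by rewrite mem_enum andbN addr0.
split.
  apply: assigned_sub; last first.
    rewrite (_ : (fun Q => _) = fun Q => a Q + (if (Q \in val A) && (Q \notin [::]) then f A Q else 0)).
      exact: assigned_res.
    by apply/funext => Q; rewrite andbT.
  by right.
by rewrite /= addn0 leq_add2l (leq_trans time_res) // leq_mul2r -cardE max_card orbT.
Qed.

End Distribute.

Lemma distribute_all_spec d (T : measurableType d) (R : realType)
    (mu : {measure set T -> \bar R}) (I : finType) (F : I -> set T) (EO2 : nat)
    (o2 : set T -> R -> timed (set T)) (f : member (nonempty_atoms F) -> I -> R) :
  let w := atom_weight mu (F := F) in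
  let c := foldM (distribute F o2 w f) (fun=> set0) (enum {: member (nonempty_atoms F)}) in
  (forall Q, measurable (F Q)) -> (forall Q, (mu (F Q) < +oo)%E) ->
  \bigcup_Q F Q = [set: T] -> subset_oracle mu EO2 o2 ->
  (forall (A : member (nonempty_atoms F)) Q, Q \in val A -> 0 <= f A Q) ->
  (forall A : member (nonempty_atoms F), \sum_(Q in val A) f A Q <= w A) ->
  assigned mu F (result c) set0
    (fun Q => \sum_(A : member (nonempty_atoms F) | Q \in val A) f A Q) /\
  (time c <= #|nonempty_atoms F| * (1 + #|I| * (EO2 + 6)))%N.
Proof.
move=> w c mF mu_fin cover o2_spec f0 fw.
pose rest (todo : seq (member (nonempty_atoms F))) := \bigcup_(A in [set` todo]) atom F (val A).
pose mass (todo : seq (member (nonempty_atoms F))) Q :=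
  \sum_(A : member (nonempty_atoms F) | Q \in val A) if A \in todo then 0 else f A Q.
pose inv E todo := uniq todo /\ assigned mu F E (rest todo) (mass todo).
have step E A todo : inv E (A :: todo) ->
    inv (result (distribute F o2 w f E A)) todo /\
    (time (distribute F o2 w f E A) <= 1 + #|I| * (EO2 + 6))%N.
  move=> [/= /andP[Atodo todo_uniq] assigned_E].
  have [||assigned_res time_res] := distribute_spec mF o2_spec (mu_atom mF mu_fin cover)
      f0 fw (E := E) (A := A) (D := rest todo) (a := mass (A :: todo)).
  - apply/seteqP; split=> // x [[B Btodo Bx] Ax].
    move: Atodo; rewrite (_ : A = B) ?Btodo //.
    by apply: (@trivIset_atom T I F setT) => //; exists x.
  - apply: assigned_sub assigned_E => x [Ax|[B Btodo Bx]].
      by exists A => //=; rewrite mem_head.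
    by exists B => //=; rewrite inE Btodo orbT.
  split=> //; split=> //; move: assigned_res; congr (assigned _ _ _ _ _).
  apply/funext => Q; rewrite /mass big_mkcond [RHS]big_mkcond.
  rewrite (bigD1 A) //= [RHS](bigD1 A) //= mem_head (negPf Atodo) if_same add0r addrC.
  congr (_ + _); apply: eq_bigr => B BA; rewrite inE (negPf BA) //.
have [|[_ assigned_res] time_res] :=
    foldM_ind step (s := fun=> set0) (xs := enum {: member (nonempty_atoms F)}).
  split; first exact: enum_uniq.
  split=> // [Q|Q1 Q2 _ _ [x []]//].
  by rewrite measure0 /mass big1 // => A _; rewrite mem_enum.
split; last by rewrite -cardE card_member in time_res.
by apply: assigned_sub assigned_res => x [].
Qed.

(** * Runtime bound and conclusion *)

(** The times follow the stages of the program, [v + e] being the construction of the network and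
    [t5] the solver. Positivity of [n] and [m] lets all lower-order terms be absorbed. *)
Lemma runtime_arith (K n m e1 e2 v e t1 t2 t3 t5 t6 t7 : nat) :
  (0 < n)%N -> (0 < m)%N -> v = (2 + (n + m))%N -> (e <= m + n + n * m)%N ->
  (t1 <= m * m + e1 + m * (n + e1 + 2 + m * 2))%N -> (t2 <= m * (n * 2))%N ->
  (t3 <= n * 2)%N -> (t5 <= K * (v * e))%N -> (t6 <= n)%N ->
  (t7 <= m * (1 + n * (e2 + 6)))%N ->
  (t1 + (t2 + (t3 + (v + e + (t5 + (t6 + t7))))) <=
   (12 * K + 40) * (m * e1 + n * m * e2 + n ^ 2 * m + n * m ^ 2))%N.
Proof.
move=> n0 m0 -> eE t1E t2E t3E t5E t6E t7E.
pose X := (n ^ 2 * m + n * m ^ 2)%N.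
have nX : (n <= X)%N by rewrite /X; nia.
have mX : (m <= X)%N by rewrite /X; nia.
have nmX : (n * m <= X)%N by rewrite /X; nia.
have mmX : (m * m <= X)%N by rewrite /X; nia.
have e1m : (e1 <= m * e1)%N by nia.
(* The factors are at most [2 * (n + m)] and [3 * (n * m)], and [n * m * (n + m)] equals [X]. *)
have veX : ((2 + (n + m)) * e <= 12 * X)%N.
  apply: (@leq_trans ((2 * (n + m)) * (3 * (n * m)))).
    by apply: leq_mul; [lia | apply: leq_trans eE _; nia].
  rewrite /X; nia.
have t5X : (t5 <= 12 * K * X)%N.
  by apply: leq_trans t5E _; rewrite [(12 * K)%N]mulnC -(mulnA K) leq_mul2l veX orbT.
have t1X : (t1 <= 2 * (m * e1) + 6 * X)%N by clearbody X; lia.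
have t7X : (t7 <= n * m * e2 + 7 * X)%N by clearbody X; lia.
have restX : (t2 + t3 + (2 + (n + m) + e) + t6 <= 14 * X)%N by clearbody X; lia.
(* Outside the solver, the multiples of [X] add up to 6 + 7 + 14 = 27, and the oracle terms have
   coefficients at most 2; 40 covers both. *)
apply: (@leq_trans (12 * K * X + 40 * (m * e1 + n * m * e2 + X)))%N.
  by clear - t1X t5X t7X restX; clearbody X; lia.
by rewrite -(addnA (_ + _)%N (n ^ 2 * m)%N) -/X mulnDl leq_add2r leq_mul2l leq_addl orbT.
Qed.

(** The constant is chosen before the space, the collection and the oracles, so it depends on the
    solver only. *)
Theorem theorem3p11 (R : realType)
    (orlin : forall N : network R, timed (flow N))
    (orlin_max : solves_max_flow orlin)
    (orlin_time : max_flow_runtime_VE orlin) :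
  exists C : nat,
  forall (d : measure_display) (T : measurableType d)
    (mu : {measure set T -> \bar R})
    (I : finType) (F : I -> set T) (L : R)
    (EO1 EO2 : nat)
    (o1 : {set I} -> timed R) (o2 : set T -> R -> timed (set T)),
  non_atomic mu ->
  (forall Q, measurable (F Q)) ->
  (forall Q, (0 < mu (F Q) < +oo)%E) ->
  \bigcup_Q F Q = [set: T] ->
  (forall A : {set I}, atom F A = set0 \/ (0 < mu (atom F A))%E) ->
  1 <= L ->
  carleson mu F L ->
  union_oracle mu F EO1 o1 ->
  subset_oracle mu EO2 o2 ->
  let P0 := nonempty_atoms F in
  let run := set_construction F P0 L o1 o2 orlin in
  let E := result run in
  let n := #|I| in
  let m := #|P0| in
  [/\ forall Q, measurable (E Q) /\ E Q `<=` F Q,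
      forall Q, (L^-1%:E * mu (F Q) <= mu (E Q))%E,
      trivIset [set: I] E &
      (time run <= C * (m * EO1 + n * m * EO2 + n ^ 2 * m + n * m ^ 2))%N].
Proof.
have [K orlinK] := orlin_time; exists (12 * K + 40)%N.
move=> d T mu I F L EO1 EO2 o1 o2 _ mF mu_bounds cover _ L1 carlesonF o1_spec o2_spec.
move=> P0 run E n m.
have mu_fin Q : (mu (F Q) < +oo)%E by case/andP: (mu_bounds Q).
have L0 : 0 < L := lt_le_trans ltr01 L1.
pose w := atom_weight mu (F := F).
(* The sink capacities in the form in which the program computes them; [mu_F] identifies them with
   the measures divided by [L]. *)
pose c Q := (\sum_(A : member P0 | Q \in val A) w A) / L.
have mu_F Q : mu (F Q) = (c Q * L)%:E by rewrite divfK ?gt_eqF // mu_set.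
have w0 A : 0 <= w A by apply: atom_weight_ge0.
have c0 Q : 0 <= c Q by rewrite divr_ge0 ?sumr_ge0 // ltW.
have hall (S : {set I}) : \sum_(Q in S) c Q <= \sum_(A in neighbours (incidence P0) S) w A.
  have := carlesonF S; rewrite (mu_union mF mu_fin cover).
  rewrite (eq_bigr (fun Q => (c Q * L)%:E)) => [|Q _]; last exact: mu_F.
  by rewrite sumEFin -EFinM lee_fin -mulr_suml mulrC ler_pM2l.
have [wE w_time] : result (atom_measures P0 o1) = w /\
    (time (atom_measures P0 o1) <= #|P0| * #|P0| + EO1 +
      #|P0| * (#|I| + EO1 + 2 + #|P0| * 2))%N.
  apply: atom_measures_spec => [S|S|A].
  - by apply: EFin_inj; have [-> _] := o1_spec S; rewrite mu_union.
  - by have [] := o1_spec S.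
  - exact: atom_nonempty.
have [qE q_time] := set_measures_spec w.
have [cE c_time] := sink_capacities_spec L (fun Q => \sum_(A : member P0 | Q \in val A) w A).
have [E0E E0_time] := init_sets_spec I T.
have flow_exists := max_flow_exists w0 c0 hall.
have max_f := orlin_max _ flow_exists.
set f := result (orlin _) in max_f.
have f_sat Q := max_flow_saturates w0 c0 hall Q max_f.
have /is_flow_carleson[f_source f_ge0 _ f_cons _] := max_f.1.
have [|assigned_E E_time] := distribute_all_spec mF mu_fin cover o2_spec f_ge0.
  (* The outflow of an atom equals the flow on its source edge, whose capacity is its weight. *)
  by move=> A; rewrite -f_cons; case/andP: (f_source A).
have runE : E = result (foldM (distribute F o2 w (fun A Q => f (VAtom A, VSet Q)))
    (fun=> set0) (enum {: member P0})).
  rewrite /E /run /set_construction.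
  (* The computed weights and capacities are replaced before the solver is reached, because the type
     of its flow depends on them. *)
  by rewrite result_bind wE result_bind qE result_bind cE !result_bind E0E.
have [mE EF muE tE] := assigned_E.
have P0_gt0 : (0 < #|P0|)%N.
  by apply/card_gt0P; exists (label F point); apply: label_nonempty.
have I_gt0 : (0 < #|I|)%N.
  have [Q _ _] : (\bigcup_Q F Q) point by rewrite cover.
  by apply/card_gt0P; exists Q.
split.
- by move=> Q; rewrite runE; split=> // x /EF[].
- move=> Q; rewrite runE muE f_sat mu_F -EFinM lee_fin.
  by rewrite mulrC mulfK ?gt_eqF.
- by rewrite runE.
have orlin_f := orlinK _ flow_exists (edges_gt0 _ _ P0_gt0).
rewrite /run /set_construction.
rewrite time_bind wE time_bind qE time_bind cE !time_bind E0E.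
apply: runtime_arith I_gt0 P0_gt0 (card_node w c) (card_edges w c) w_time q_time c_time
  orlin_f E0_time E_time.
Qed.
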